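(* Let $P\subset\mathbb{Z}^n$ be a nonempty M-convex set (not necessarily finite). (1) The cones $C_P(\mathbf a)$, for $\mathbf a\in P$, are pairwise disjoint and their union is $\mathbb{Z}^n$: $$\biguplus_{\mathbf a\in P}C_P(\mathbf a)=\mathbb{Z}^n.$$ (2) If $\mathbf a\in P$ and $\mathbf c\in C_P(\mathbf a)$, then $d_1(\mathbf a,\mathbf c)=d_1(P,\mathbf c)$. In other words, $\mathbf a$ is one of the points of $P$ closest to $\mathbf c$ with respect to the Manhattan distance.
   Context: Notation: $[n]=\{1,\dots,n\}$; $\mathbf e_1,\dots,\mathbf e_n$ is the canonical basis of $\mathbb{R}^n$. An M-convex set is a subset $P\subset\mathbb{Z}^n$ such that for any $\mathbf a,\mathbf b\in P$ and any $i\in[n]$ with $a_i>b_i$, there exists $j\in[n]$ with $a_j<b_j$ and both $\mathbf a-\mathbf e_i+\mathbf e_j$ and $\mathbf b+\mathbf e_i-\mathbf e_j$ in $P$. For $\mathbf a\in P$, an index $i\in[n]$ is internally active if there is no $j<i$ with $\mathbf a-\mathbf e_i+\mathbf e_j\in P$, and externally active if there is no $j<i$ with $\mathbf a+\mathbf e_i-\mathbf e_j\in P$. $\mathrm{Int}(\mathbf a)$ and $\mathrm{Ext}(\mathbf a)$ denote the sets of such indices. For $\mathbf a\in P$, the cone $C_P(\mathbf a)\subset\mathbb{Z}^n$ consists of all points $\mathbf a+\mathbf x$ with $\mathbf x\in\mathbb{Z}^n$ such that for each $i\in[n]$: $x_i=0$ if $i\notin\mathrm{Int}(\mathbf a)\cup\mathrm{Ext}(\mathbf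 a)$; $x_i\le0$ if $i\in\mathrm{Int}(\mathbf a)\setminus\mathrm{Ext}(\mathbf a)$; $x_i\ge0$ if $i\in\mathrm{Ext}(\mathbf a)\setminus\mathrm{Int}(\mathbf a)$; and $x_i$ is an arbitrary integer if $i\in\mathrm{Int}(\mathbf a)\cap\mathrm{Ext}(\mathbf a)$. The Manhattan distance is $d_1(\mathbf a,\mathbf b)=\sum_{i=1}^n|a_i-b_i|$, and $d_1(P,\mathbf c)=\min_{\mathbf a\in P}d_1(\mathbf a,\mathbf c)$. *)

(* Defs.v *)
From HB Require Import structures.
From mathcomp Require Import all_boot all_order all_algebra.
From mathcomp Require Import boolp classical_sets.

Set Implicit Arguments.
Unset Strict Implicit.
Unset Printing Implicit Defensive.
Import Order.TTheory GRing.Theory Num.Theory.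

Local Open Scope classical_set_scope.
Local Open Scope ring_scope.

(* The index set [n] is 'I_n with its usual order: indices start at 0 rather
   than 1. *)

Definition unit_vec (n : nat) (i : 'I_n) : 'rV[int]_n := delta_mx 0 i.

Definition M_convex (n : nat) (P : set 'rV[int]_n) : Prop :=
  forall a b, P a -> P b -> forall i : 'I_n, b 0 i < a 0 i ->
  exists j : 'I_n, [/\ a 0 j < b 0 j,
    P (a - unit_vec i + unit_vec j) & P (b + unit_vec i - unit_vec j)].

Definition Int_act (n : nat) (P : set 'rV[int]_n) (a : 'rV[int]_n) : set 'I_n :=
  [set i : 'I_n | ~ exists2 j : 'I_n, (j < i)%N & P (a - unit_vec i + unit_vec j)].

Definition Ext_act (n : nat) (P : set 'rV[int]_n) (a : 'rV[int]_n) : set 'I_n :=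
  [set i : 'I_n | ~ exists2 j : 'I_n, (j < i)%N & P (a + unit_vec i - unit_vec j)].

Definition cone (n : nat) (P : set 'rV[int]_n) (a : 'rV[int]_n) :
    set 'rV[int]_n :=
  [set a + x | x in [set x : 'rV[int]_n | forall i : 'I_n,
    [/\ ~ (Int_act P a `|` Ext_act P a) i -> x 0 i = 0,
        (Int_act P a `\` Ext_act P a) i -> x 0 i <= 0
      & (Ext_act P a `\` Int_act P a) i -> 0 <= x 0 i]]].

Definition d1 (n : nat) (a b : 'rV[int]_n) : nat :=
  (\sum_(i < n) absz (a ord0 i - b ord0 i)%R)%N.

Definition is_min_nat (A : set nat) (m : nat) : Prop :=
  A m /\ forall k, A k -> (m <= k)%N.

(* The default value 0 is only taken when A is empty, see [min_natP]. *)
Definition min_nat (A : set nat) : nat := xget 0%N (is_min_nat A).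

Lemma min_natP (A : set nat) : A !=set0 -> is_min_nat A (min_nat A).
Proof.
move=> [k Ak]; have exA : exists k, `[< A k >] by exists k; apply/asboolP.
case: (ex_minnP exA) => m /asboolP Am mP; apply: (@xgetPex _ 0%N (is_min_nat A)).
by exists m; split=> // l Al; apply/mP/asboolP.
Qed.

Definition d1_set (n : nat) (P : set 'rV[int]_n) (c : 'rV[int]_n) : nat :=
  min_nat [set d1 a c | a in P].

(* Main.v *)
Require Import Defs.
From HB Require Import structures.
From mathcomp Require Import all_boot all_order all_algebra.
From mathcomp Require Import boolp classical_sets.
From mathcomp Require Import zify.

Set Implicit Arguments.
Unset Strict Implicit.
Unset Printing Implicit Defensive.
Import Order.TTheory GRing.Theory Num.Theory.

Local Open Scope classical_set_scope.
Local Open Scope ring_scope.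

(** Fix a point [c] and measure the distance to [c] with a weight [w i] on each
coordinate.  A move [b + e_i - e_j] or [b - e_i + e_j] with [j < i] that brings
coordinate [i] closer to [c] gains [w i] and loses at most [w j]
([wdist_transfer]); so it never hurts when [w] is nondecreasing, and strictly
improves when [w] is increasing.  On the other hand, [c] lies in the cone of [a]
exactly when no such move starting from [a] stays in [P] ([coneP]).

Existence: a point of [P] minimizing the distance for the weights [i + 1] admits
no improving move, so its cone contains [c] ([cone_cover]).

Conversely, let [c] lie in the cone of [a], and let [b] be another point of [P].
Let [i] be the last coordinate where [a] and [b] differ, say [b_i < a_i].  The
index [j] given by M-convexity satisfies [j < i] by maximality of [i], and
[a - e_i + e_j] is in [P]; hence [i] is not internally active for [a], which
forces [a_i <= c_i].  Then [b_i < c_i], so [b + e_i - e_j] is a move in [P]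
improving [b] ([cone_improve]).  Repeating this, [b] descends to [a], and thus
[a] is the closest point of [P] to [c]: weakly for the constant weight, which
is the Manhattan distance, and strictly for the weights [i + 1], which makes [a]
unique. *)

Definition wdist (n : nat) (w : 'I_n -> nat) (a b : 'rV[int]_n) : nat :=
  (\sum_(i < n) w i * absz (a 0 i - b 0 i)%R)%N.

Lemma d1_wdist (n : nat) (a b : 'rV[int]_n) : d1 a b = wdist (fun=> 1%N) a b.
Proof. by apply: eq_bigr => i _; rewrite mul1n. Qed.

Lemma wdist_transfer (n : nat) (w : 'I_n -> nat) (b b' c : 'rV[int]_n)
    (i j : 'I_n) : j != i ->
  (forall k, k != i -> k != j -> b' 0 k = b 0 k) ->
  (absz (b' 0 i - c 0 i)%R).+1 = absz (b 0 i - c 0 i)%R ->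
  (absz (b' 0 j - c 0 j)%R <= (absz (b 0 j - c 0 j)%R).+1)%N ->
  (wdist w b' c + w i <= wdist w b c + w j)%N.
Proof.
move=> ji b'E b'i b'j.
rewrite /wdist (bigD1 i) //= (bigD1 j) //= [in leqRHS](bigD1 i) //=.
rewrite [in leqRHS](bigD1 j) //= -b'i mulnS.
rewrite [X in (_ + (_ + X) + _ <= _)%N](eq_bigr
  (fun k => w k * absz (b 0 k - c 0 k)%R)%N); last first.
  by move=> k /andP[ki kj]; rewrite b'E.
have := leq_mul (leqnn (w j)) b'j; rewrite mulnS; lia.
Qed.

Lemma wdist_add_sub (n : nat) (w : 'I_n -> nat) (b c : 'rV[int]_n)
    (i j : 'I_n) : (j < i)%N -> b 0 i < c 0 i ->
  (wdist w (b + unit_vec i - unit_vec j) c + w i <= wdist w b c + w j)%N.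
Proof.
move=> ltji bci; have ji : j != i by rewrite -val_eqE neq_ltn ltji.
apply: wdist_transfer => // [k /negPf ki /negPf kj||].
- by rewrite !mxE /= ki kj subr0 addr0.
- by rewrite !mxE /= eqxx eq_sym (negPf ji); lia.
- by rewrite !mxE /= eqxx (negPf ji); lia.
Qed.

Lemma wdist_sub_add (n : nat) (w : 'I_n -> nat) (b c : 'rV[int]_n)
    (i j : 'I_n) : (j < i)%N -> c 0 i < b 0 i ->
  (wdist w (b - unit_vec i + unit_vec j) c + w i <= wdist w b c + w j)%N.
Proof.
move=> ltji bci; have ji : j != i by rewrite -val_eqE neq_ltn ltji.
apply: wdist_transfer => // [k /negPf ki /negPf kj||].
- by rewrite !mxE /= ki kj subr0 addr0.
- by rewrite !mxE /= eqxx eq_sym (negPf ji); lia.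
- by rewrite !mxE /= eqxx (negPf ji); lia.
Qed.

(** Replaces the description of the cone by sign patterns of [c - a] with the
form used in all arguments: a coordinate may only deviate from [a] in a
direction in which it is active. *)
Lemma coneP (n : nat) (P : set 'rV[int]_n) (a c : 'rV[int]_n) :
  cone P a c <-> forall i : 'I_n,
    (a 0 i < c 0 i -> Ext_act P a i) /\ (c 0 i < a 0 i -> Int_act P a i).
Proof.
split=> [[x xP <-] i|H].
  have [x0 xle xge] := xP i; rewrite !mxE ltrDl gtrDl.
  split=> xi; apply: contrapT => Nact.
  - have [I|NI] := pselect (Int_act P a i).
      by move: xi; rewrite ltNge xle.
    by move: xi; rewrite x0 ?ltxx //; case.
  - have [E|NE] := pselect (Ext_act P a i).
      by move: xi; rewrite ltNge xge.
    by move: xi; rewrite x0 ?ltxx //; case.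
exists (c - a); last by rewrite addrC subrK.
move=> i; have [HE HI] := H i; rewrite !mxE; split.
- move=> N; case: (ltgtP (a 0 i) (c 0 i)) => [/HE E|/HI I|->].
  + by case: N; right.
  + by case: N; left.
  + by rewrite subrr.
- by case=> _ NE; rewrite subr_le0 leNgt; apply/negP => /HE.
- by case=> _ NI; rewrite subr_ge0 leNgt; apply/negP => /HI.
Qed.

Lemma cone_cover (n : nat) (P : set 'rV[int]_n) (c : 'rV[int]_n) :
  P !=set0 -> exists2 a, P a & cone P a c.
Proof.
move=> [p Pp]; pose D a := wdist (fun i : 'I_n => i.+1) a c.
have [|[a Pa Da] amin] := @min_natP [set D a | a in P].
  by exists (D p), p.
exists a => //; apply/coneP => i.
split=> aci [j ltji Pb].
- have /amin := imageP D Pb; rewrite -Da.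
  by have := wdist_add_sub (fun i : 'I_n => i.+1) ltji aci; rewrite /D; lia.
- have /amin := imageP D Pb; rewrite -Da.
  by have := wdist_sub_add (fun i : 'I_n => i.+1) ltji aci; rewrite /D; lia.
Qed.

(** The improving move does not depend on the weights, so that a single descent
from [b] to [a] can be measured with two different weights at once. *)
Lemma cone_improve (n : nat) (P : set 'rV[int]_n) (a b c : 'rV[int]_n) :
  M_convex P -> P a -> P b -> cone P a c -> b != a ->
  exists b' (i j : 'I_n), [/\ P b', (j < i)%N &
    forall w, (wdist w b' c + w i <= wdist w b c + w j)%N].
Proof.
move=> Pconv Pa Pb /coneP Cac neq_ba.
have [i0 ne_i0] : exists i, a 0 i != b 0 i.
  apply/existsP; apply: contraNT neq_ba; rewrite negb_exists => /forallP E.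
  by apply/eqP/rowP => i; have := E i; rewrite negbK => /eqP.
(* With [i] the last coordinate where [a] and [b] differ, the exchange index is
   automatically smaller than [i], as activity requires. *)
case: (@arg_maxnP _ i0 (fun i => a 0 i != b 0 i) val ne_i0) => i ne_i imax.
have lt_max j : a 0 j != b 0 j -> j != i -> (j < i)%N.
  by move=> ne_j ji; rewrite ltn_neqAle val_eqE ji; apply: imax.
have [CE CI] := Cac i.
case: (ltgtP (b 0 i) (a 0 i)) => [lt_ba|lt_ab|/eqP]; last first.
- by rewrite eq_sym (negPf ne_i).
- have [j [lt_ba_j Pb' Pa']] := Pconv b a Pb Pa i lt_ab.
  have ltji : (j < i)%N.
    apply: lt_max; first by rewrite gt_eqF.
    by apply: contraTneq lt_ab => <-; rewrite -leNgt ltW.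
  exists (b - unit_vec i + unit_vec j), i, j; split=> // w.
  apply: wdist_sub_add => //; apply: le_lt_trans lt_ab.
  by rewrite leNgt; apply/negP => /CE; apply; exists j.
- have [j [lt_ab_j Pa' Pb']] := Pconv a b Pa Pb i lt_ba.
  have ltji : (j < i)%N.
    apply: lt_max; first by rewrite lt_eqF.
    by apply: contraTneq lt_ba => <-; rewrite -leNgt ltW.
  exists (b + unit_vec i - unit_vec j), i, j; split=> // w.
  apply: wdist_add_sub => //; apply: lt_le_trans lt_ba _.
  by rewrite leNgt; apply/negP => /CI; apply; exists j.
Qed.

Lemma cone_wdist_le (n : nat) (P : set 'rV[int]_n) (w : 'I_n -> nat)
    (a b c : 'rV[int]_n) :
  M_convex P -> {homo w : i j / (i < j)%N >-> (i <= j)%N} ->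
  P a -> P b -> cone P a c -> (wdist w a c <= wdist w b c)%N.
Proof.
move=> Pconv w_homo Pa + Cac.
(* The descent is bounded through the weights [i + 1], which every improving
   move makes strictly smaller whatever [w] is. *)
have [m] := ubnP (wdist (fun i : 'I_n => i.+1) b c).
elim: m b => // m IHm b lt_bm Pb; have [-> //|neq_ba] := eqVneq b a.
have [b' [i [j [Pb' ltji le_b'b]]]] := cone_improve Pconv Pa Pb Cac neq_ba.
have le_ab' : (wdist w a c <= wdist w b' c)%N.
  by apply: IHm => //; have := le_b'b (fun i => i.+1); lia.
by have := le_b'b w; have := w_homo _ _ ltji; lia.
Qed.

Lemma cone_wdist_lt (n : nat) (P : set 'rV[int]_n) (w : 'I_n -> nat)
    (a b c : 'rV[int]_n) :
  M_convex P -> {homo w : i j / (i < j)%N} ->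
  P a -> P b -> cone P a c -> b != a -> (wdist w a c < wdist w b c)%N.
Proof.
move=> Pconv w_homo Pa Pb Cac neq_ba.
have [b' [i [j [Pb' ltji le_b'b]]]] := cone_improve Pconv Pa Pb Cac neq_ba.
have le_ab' : (wdist w a c <= wdist w b' c)%N.
  by apply: (cone_wdist_le Pconv) => // k l /w_homo /ltnW.
by have := le_b'b w; have := w_homo _ _ ltji; lia.
Qed.

Theorem theorem9p3 (n : nat) (P : set 'rV[int]_n) (P_nonempty : P !=set0)
    (P_M_convex : M_convex P) :
  (trivIset P (cone P) /\ \bigcup_(a in P) cone P a = [set: 'rV[int]_n])
  /\ (forall a c : 'rV[int]_n, P a -> cone P a c -> d1 a c = d1_set P c).
Proof.
split; first split.
- move=> a b Pa Pb [c [Cac Cbc]]; apply/eqP; apply: contraT => neq_ab.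
  have S_homo : {homo (fun i : 'I_n => i.+1) : i j / (i < j)%N} by [].
  have := cone_wdist_lt P_M_convex S_homo Pb Pa Cbc neq_ab.
  rewrite eq_sym in neq_ab.
  by have := cone_wdist_lt P_M_convex S_homo Pa Pb Cac neq_ab; lia.
- apply/seteqP; split=> // c _.
  by have [a Pa Cac] := cone_cover c P_nonempty; exists a.
- move=> a c Pa Cac.
  have [|[b Pb eq_b] bmin] := @min_natP [set d1 a c | a in P].
    by exists (d1 a c), a.
  apply/eqP; rewrite eqn_leq; apply/andP; split; last by apply: bmin; exists a.
  by rewrite -[d1_set P c]eq_b !d1_wdist; apply: (cone_wdist_le P_M_convex).
Qed.
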